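(* Let $\lambda$ be a partition of $n$ and $\mathfrak{t}\in\mathfrak{T}_n(\lambda)$. If $k$ is an integer, $0\le k\le n$, then there exist $a_{\mathfrak{v}}\in R$, for $\mathfrak{v}\in\mathfrak{T}_n(\lambda)$, such that in $C^\lambda$ $$m_{\mathfrak{t}}T_k=r_{\mathfrak{t}}(k)\,m_{\mathfrak{t}}+\sum_{\mathfrak{v}\rhd\mathfrak{t}}a_{\mathfrak{v}}m_{\mathfrak{v}}.$$
   Context: Let $x$ be an indeterminate and $R=\mathbb{Z}[x]$. The Temperley–Lieb algebra $\mathcal{A}_n(x)$ is the unital associative $R$-algebra generated by $e_1,\dots,e_{n-1}$ subject to $e_i^2=xe_i$; $e_ie_{i\pm1}e_i=e_i$ (whenever both indices lie in $\{1,\dots,n-1\}$); $e_ie_j=e_je_i$ for $|i-j|\ge2$. By convention $\mathcal{A}_1(x)=R$, and $\mathcal{A}_i(x)$ is regarded as the subalgebra of $\mathcal{A}_{i+1}(x)$ generated by $e_1,\dots,e_{i-1}$. A partition of $n$ means a pair of integers $(i,n-2i)$ with $0\le 2i\le n$. For partitions $\lambda=(i,n-2i)$, $\mu=(j,n-2j)$ of $n$, $\lambda\unrhd\mu$ means $i\ge j$, and $\lambda\rhd\mu$ means $\lambda\unrhd\mu$ and $\lambda\ne\mu$. If $\mu$ is a partition of $n-1$ and $\lambda=(i,n-2i)$ a partition of $n$, write $\mu\to\lambda$ if $\mu=(i,n-2i-1)$ or $\mu=(i-1,n-2i+1)$. $\mathfrak{T}_n(\lambda)$ is the set of sequences $(\lambda^{(0)},\dots,\lambda^{(n)})$,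 with $\lambda^{(k)}$ a partition of $k$, such that $\lambda^{(0)}=(0,0)$, $\lambda^{(k-1)}\to\lambda^{(k)}$ for $k=1,\dots,n$, and $\lambda^{(n)}=\lambda$. For $\mathfrak{s}=(\lambda^{(0)},\dots,\lambda^{(n)})$ write $\mathrm{Shape}(\mathfrak{s})=\lambda^{(n)}$ and $\mathfrak{s}|_k=(\lambda^{(0)},\dots,\lambda^{(k)})$. For $\mathfrak{s},\mathfrak{t}\in\mathfrak{T}_n(\lambda)$, $\mathfrak{s}\unrhd\mathfrak{t}$ means $\mathrm{Shape}(\mathfrak{s}|_k)\unrhd\mathrm{Shape}(\mathfrak{t}|_k)$ for $k=1,\dots,n$; $\mathfrak{s}\rhd\mathfrak{t}$ means in addition $\mathfrak{s}\neq\mathfrak{t}$. For $\lambda=(f,n-2f)$ let $m_\lambda=e_1e_3\cdots e_{2f-1}$ ($=1$ if $f=0$). $\mathcal{A}_n^\lambda$ is the two-sided ideal of $\mathcal{A}_n(x)$ generated by $m_\lambda$ and $\check{\mathcal{A}}_n^\lambda=\sum_{\mu\rhd\lambda}\mathcal{A}_n^\mu$. Put $w_{i,j}=e_ie_{i+1}\cdots e_{j-1}$ if $i<j$, $w_{i,j}=e_{i-1}e_{i-2}\cdots e_j$ if $j<i$, $w_{i,i}=1$. Define $v_{\mathfrak{t}}=1$ if $\mathfrak{t}=((0,0))$; if $\mathfrak{t}\in\mathfrak{T}_n(\lambda)$, $\lambda=(f,n-2f)$, $\mathfrak{s}=\mathfrak{t}|_{n-1}$, then $v_{\mathfrak{t}}=v_{\mathfrak{s}}$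 if $\mathrm{Shape}(\mathfrak{s})=(f,n-2f-1)$ and $v_{\mathfrak{t}}=w_{2f,n}v_{\mathfrak{s}}$ if $\mathrm{Shape}(\mathfrak{s})=(f-1,n-2f+1)$. $C^\lambda$ is the right $\mathcal{A}_n(x)$-submodule of $\mathcal{A}_n(x)/\check{\mathcal{A}}_n^\lambda$ generated by $m_\lambda+\check{\mathcal{A}}_n^\lambda$, and $m_{\mathfrak{t}}=m_\lambda v_{\mathfrak{t}}+\check{\mathcal{A}}_n^\lambda\in C^\lambda$ for $\mathfrak{t}\in\mathfrak{T}_n(\lambda)$. Define $T_0=T_1=0$, $T_2=e_1$ and $T_{i+1}=-e_iT_i-T_ie_i+e_ie_{i-1}T_ie_i-z_{i-1}-e_iz_{i-2}$ for $i\ge2$, where $z_0=z_1=0$ and $z_i=\sum_{k=0}^ix^kT_{i-k}$ for $i\ge2$. Define $p_0=0$, $p_1=1$, $p_{i+1}=xp_i-p_{i-1}$ for $i\ge 1$. For $\mathfrak{t}\in\mathfrak{T}_n(\lambda)$ define $r_{\mathfrak{t}}(0)=r_{\mathfrak{t}}(1)=0$ and, for $k=2,\dots,n$ with $\mathrm{Shape}(\mathfrak{t}|_k)=(i,k-2i)$: $r_{\mathfrak{t}}(k)=(p_i-xp_{i-1})p_{k-i+1}$ if $\mathrm{Shape}(\mathfrak{t}|_{k-1})=(i-1,k-2i+1)$, and $r_{\mathfrak{t}}(k)=(p_{k-i+1}-xp_{k-i})p_i$ if $\mathrm{Shape}(\mathfrak{t}|_{k-1})=(i,k-2i-1)$.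 *)

(* Defs.v *)
From HB Require Import structures.
From mathcomp Require Import all_boot all_order all_algebra.
From mathcomp Require Import generic_quotient ring_quotient boolp.
From mathcomp Require Import monalg.

Set Implicit Arguments.
Unset Strict Implicit.
Unset Printing Implicit Defensive.

Import GRing.Theory.
Local Open Scope ring_scope.
Local Open Scope quotient_scope.

(* Quotient of a left module by a submodule; the underlying Z-module is the
   library's {quot W}. *)
Section QuotientModule.
Variables (R : nzRingType) (V : lmodType R) (W : submodClosed V).

(* A submodClosed predicate is not declared to be a zmodClosed one. *)
Definition zmod_pred : {pred V} := W.
Fact zmod_pred_closed : zmod_closed zmod_pred.
Proof.
split; first exact: (@rpred0 _ W).
by move=> a b Wa Wb; rewrite -scaleN1r; apply: (@rpredD _ W) => //; exact: rpredZ.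
Qed.
HB.instance Definition _ := GRing.isZmodClosed.Build V zmod_pred zmod_pred_closed.

Definition quotmod : Type := Quotient.quot zmod_pred.
HB.instance Definition _ := Choice.on quotmod.
HB.instance Definition _ := GRing.Zmodule.on quotmod.

Definition qpi (a : V) : quotmod := \pi_(Quotient.quot zmod_pred) a.
Definition qrepr (c : quotmod) : V := repr (c : Quotient.quot zmod_pred).

Lemma qreprK c : qpi (qrepr c) = c.
Proof. exact: reprK. Qed.

Lemma qpi_eqE a b : (qpi a == qpi b) = (a - b \in W).
Proof. by rewrite /qpi (Quotient.idealrBE zmod_pred). Qed.

Lemma qpiP a b : reflect (qpi a = qpi b) (a - b \in W).
Proof. by rewrite -qpi_eqE; apply: eqP. Qed.

Lemma qpiD : {morph qpi : a b / a + b}.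
Proof. by move=> a b; exact: (Quotient.pi_add zmod_pred). Qed.

Lemma qpi0 : qpi 0 = 0.
Proof. by apply: (addrI (qpi 0)); rewrite -qpiD !addr0. Qed.

Lemma qpi_repr a : qrepr (qpi a) - a \in W.
Proof. by apply/qpiP; rewrite qreprK. Qed.

Definition qscale (k : R) (c : quotmod) : quotmod := qpi (k *: qrepr c).

Lemma qscaleE k a : qscale k (qpi a) = qpi (k *: a).
Proof. by apply/qpiP; rewrite -scalerBr rpredZ ?qpi_repr. Qed.

Fact qscaleA a b c : qscale a (qscale b c) = qscale (a * b) c.
Proof. by rewrite -[c]qreprK !qscaleE scalerA. Qed.
Fact qscale1 : left_id 1 qscale.
Proof. by move=> c; rewrite -[c]qreprK qscaleE scale1r. Qed.
Fact qscaleDr : right_distributive qscale +%R.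
Proof.
move=> k c d; rewrite -[c]qreprK -[d]qreprK.
by rewrite -qpiD !qscaleE scalerDr qpiD.
Qed.
Fact qscaleDl c : {morph qscale^~ c : a b / a + b}.
Proof. by move=> a b; rewrite -[c]qreprK !qscaleE scalerDl qpiD. Qed.

HB.instance Definition _ := GRing.Zmodule_isLmodule.Build R quotmod
  qscaleA qscale1 qscaleDr qscaleDl.

Lemma qpiZ k a : qpi (k *: a) = k *: qpi a.
Proof. by rewrite -qscaleE. Qed.

End QuotientModule.
Arguments qpi {R V} W a.

(* The two-sided ideal generated by S. *)
Inductive ideal2 (A : nzRingType) (S : A -> Prop) : A -> Prop :=
| ideal2_gen a of S a : ideal2 S a
| ideal2_0 : ideal2 S 0
| ideal2_add a b of ideal2 S a & ideal2 S b : ideal2 S (a + b)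
| ideal2_mull b a of ideal2 S a : ideal2 S (b * a)
| ideal2_mulr a b of ideal2 S a : ideal2 S (a * b).

Lemma ideal2Z (R : nzRingType) (A : lalgType R) (S : A -> Prop) k a :
  ideal2 S a -> ideal2 S (k *: a).
Proof. by move=> Sa; rewrite -[a]mul1r scalerAl; apply: ideal2_mull. Qed.

Lemma malg_scaleAr (K : monomType) (S : comNzRingType) k (a b : {malg S[K]}) :
  k *: (a * b) = a * (k *: b).
Proof.
apply/malgP => u; rewrite mcoeffZ.
rewrite (@mcoeffMlw _ _ (msupp a) (msupp b) a b) //.
rewrite (@mcoeffMlw _ _ (msupp a) (msupp b) a (k *: b)) ?msuppZ_le //.
rewrite mulr_sumr; apply: eq_bigr => v _; rewrite mulr_sumr.
by apply: eq_bigr => v' _; rewrite mcoeffZ mulrnAr mulrCA.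
Qed.

(* The algebra A_n(x), for an arbitrary parameter x of a commutative ring R; the
   statement takes R = Z[x] and x the indeterminate. *)
Section TemperleyLieb.
Variables (R : comNzRingType) (x : R) (n : nat).

Definition tl_index : Type := {i : nat | 0 < i < n}%N.
HB.instance Definition _ := Choice.on tl_index.

Definition tl_free : Type := {malg R[{fmonom tl_index}]}.
HB.instance Definition _ := GRing.Lalgebra.on tl_free.

Definition tl_letter (i : tl_index) : tl_free := << fmu i >>.

Inductive tl_rel : tl_free -> Prop :=
| tl_rel_sq (i : tl_index) :
    tl_rel (tl_letter i * tl_letter i - x *: tl_letter i)
| tl_rel_braid (i j : tl_index) of (val i == (val j).+1) || (val j == (val i).+1) :
    tl_rel (tl_letter i * tl_letter j * tl_letter i - tl_letter i)
| tl_rel_comm (i j : tl_index) of ((val i).+1 < val j)%N || ((val j).+1 < val i)%N :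
    tl_rel (tl_letter i * tl_letter j - tl_letter j * tl_letter i).

Definition tl_ideal : {pred tl_free} := fun a => `[< ideal2 tl_rel a >].

Fact tl_ideal_closed : subsemimod_closed tl_ideal.
Proof.
split; first split.
- exact/asboolP/ideal2_0.
- by move=> a b /asboolP Ia /asboolP Ib; apply/asboolP/ideal2_add.
- by move=> k a /asboolP Ia; apply/asboolP/ideal2Z.
Qed.
HB.instance Definition _ :=
  GRing.isSubmodClosed.Build R tl_free tl_ideal tl_ideal_closed.

Definition TL : Type := quotmod tl_ideal.
HB.instance Definition _ := GRing.Lmodule.on TL.

Local Notation pi a := (qpi tl_ideal a : TL).

Definition tl_one : TL := pi 1.
Definition tl_mul (a b : TL) : TL := pi (qrepr a * qrepr b).

Lemma tl_mulE a b : tl_mul (pi a) (pi b) = pi (a * b).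
Proof.
apply/qpiP; set a' := qrepr _; set b' := qrepr _.
have -> : a' * b' - a * b = (a' - a) * b' + a * (b' - b).
  by rewrite mulrBl mulrBr addrA subrK.
by rewrite rpredD //; apply/asboolP; [apply: ideal2_mulr | apply: ideal2_mull];
   apply/asboolP; exact: (@qpi_repr _ _ tl_ideal).
Qed.

Fact tl_mulA : associative tl_mul.
Proof.
move=> a b c; rewrite -[a]qreprK -[b]qreprK -[c]qreprK.
by rewrite !tl_mulE mulrA.
Qed.
Fact tl_mul1 : left_id tl_one tl_mul.
Proof. by move=> a; rewrite -[a]qreprK tl_mulE mul1r. Qed.
Fact tl_1mul : right_id tl_one tl_mul.
Proof. by move=> a; rewrite -[a]qreprK tl_mulE mulr1. Qed.
Fact tl_mulDl : left_distributive tl_mul +%R.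
Proof.
move=> a b c; rewrite -[a]qreprK -[b]qreprK -[c]qreprK.
by rewrite -qpiD !tl_mulE mulrDl qpiD.
Qed.
Fact tl_mulDr : right_distributive tl_mul +%R.
Proof.
move=> a b c; rewrite -[a]qreprK -[b]qreprK -[c]qreprK.
by rewrite -qpiD !tl_mulE mulrDr qpiD.
Qed.

(* The augmentation e_i |-> 0 is the constant coefficient. *)
Definition tl_aug : tl_free -> R := @mcoeff {fmonom tl_index} R mone.

Lemma tl_ideal_aug (a : tl_free) : ideal2 tl_rel a -> tl_aug a = 0.
Proof.
have aug i : tl_aug (tl_letter i) = 0.
  rewrite /tl_aug /tl_letter mcoeffU1 -val_eqE /= (_ : _ == _ = false) //.
  by rewrite fm1 fmU.
have augD : {morph tl_aug : u v / u + v} by move=> u v; apply: mcoeffD.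
have augB : {morph tl_aug : u v / u - v} by move=> u v; apply: mcoeffB.
have augM : {morph tl_aug : u v / u * v}.
  by move=> u v; apply: (rmorphM (@mcoeff {fmonom tl_index} R mone)).
have augZ k u : tl_aug (k *: u) = k * tl_aug u by apply: mcoeffZ.
have aug0 : tl_aug 0 = 0 by apply: mcoeff0.
move: tl_aug aug augD augB augM augZ aug0 => F aug augD augB augM augZ aug0.
elim=> [_ [i|i j _|i j _]||b c _ hb _ hc|b c _ hc|b c _ hb].
- by rewrite augB augZ augM aug !mulr0 subrr.
- move: (tl_letter i) (aug i) (tl_letter j) (aug j) => u Fu v Fv.
  by rewrite augB 2!augM Fu Fv mulr0 subrr.
- move: (tl_letter i) (aug i) (tl_letter j) (aug j) => u Fu v Fv.
  by rewrite augB 2!augM Fu Fv mulr0 subrr.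
- exact: aug0.
- by rewrite augD hb hc addr0.
- by rewrite augM hc mulr0.
- by rewrite augM hb mul0r.
Qed.

Fact tl_one_neq0 : tl_one != 0.
Proof.
rewrite /tl_one -(qpi0 tl_ideal) qpi_eqE subr0; apply/asboolP.
by move=> /tl_ideal_aug /eqP; rewrite /tl_aug mcoeff1 eqxx oner_eq0.
Qed.

HB.instance Definition _ := GRing.Zmodule_isNzRing.Build TL
  tl_mulA tl_mul1 tl_1mul tl_mulDl tl_mulDr tl_one_neq0.

Lemma qpiM (a b : tl_free) : pi (a * b) = pi a * pi b :> TL.
Proof. by rewrite -tl_mulE. Qed.

Fact tl_scaleAl (k : R) (a b : TL) : k *: (a * b) = (k *: a) * b.
Proof.
rewrite -[a]qreprK -[b]qreprK -qpiM -!qpiZ -qpiM.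
by rewrite scalerAl.
Qed.
HB.instance Definition _ := GRing.Lmodule_isLalgebra.Build R TL tl_scaleAl.

Fact tl_scaleAr (k : R) (a b : TL) : k *: (a * b) = a * (k *: b).
Proof.
rewrite -[a]qreprK -[b]qreprK -qpiM -!qpiZ -qpiM.
by rewrite malg_scaleAr.
Qed.
HB.instance Definition _ := GRing.Lalgebra_isAlgebra.Build R TL tl_scaleAr.

(* tl_e i is the generator e_i for 0 < i < n; the value 0 elsewhere is junk. *)
Definition tl_e (i : nat) : TL :=
  if insub i is Some j then pi (tl_letter j) else 0.

Lemma e_sq i : tl_e i * tl_e i = x *: tl_e i.
Proof.
rewrite /tl_e; case: insubP => [j _ _|_]; last by rewrite mulr0 scaler0.
rewrite -qpiM -qpiZ; apply/qpiP/asboolP/ideal2_gen; exact: tl_rel_sq.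
Qed.

Lemma e_braid i j : (0 < i < n)%N -> (0 < j < n)%N ->
  (i == j.+1) || (j == i.+1) -> tl_e i * tl_e j * tl_e i = tl_e i.
Proof.
move=> hi hj hij; rewrite /tl_e !insubT.
rewrite -!qpiM; apply/qpiP/asboolP/ideal2_gen; exact: tl_rel_braid.
Qed.

Lemma e_comm i j : (i.+1 < j)%N || (j.+1 < i)%N ->
  tl_e i * tl_e j = tl_e j * tl_e i.
Proof.
rewrite /tl_e; case: insubP => [i' _ <-|_]; last by rewrite mul0r mulr0.
case: insubP => [j' _ <-|_ _]; last by rewrite mul0r mulr0.
move=> hij; rewrite -!qpiM; apply/qpiP/asboolP/ideal2_gen; exact: tl_rel_comm.
Qed.

End TemperleyLieb.
Arguments TL {R} x n.
Arguments tl_e {R} x n i.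

(* Shapes are pairs (i, j) of naturals; (i, j) is a partition of n when
   2i + j = n, that is j = n - 2i. *)
Definition tl_shape : Type := (nat * nat)%type.
HB.instance Definition _ := Countable.on tl_shape.

Definition is_part (n : nat) (la : tl_shape) : bool := (2 * la.1 + la.2 == n)%N.

Record tl_partn (n : nat) := Partn { pshape :> tl_shape; _ : is_part n pshape }.
HB.instance Definition _ n := [isSub for @pshape n].
HB.instance Definition _ n := [Countable of tl_partn n by <:].

Definition dominates (la mu : tl_shape) : bool := (mu.1 <= la.1)%N.
Definition sdominates (la mu : tl_shape) : bool := dominates la mu && (la != mu).

(* On partitions mu of n - 1 and la of n. *)
Definition arrow (mu la : tl_shape) : bool :=
  (la == (mu.1, mu.2.+1)) || ((mu.1.+1, mu.2) == (la.1, la.2.+1)).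

Definition restr (k : nat) (t : seq tl_shape) : seq tl_shape := take k.+1 t.
Definition Shape (t : seq tl_shape) : tl_shape := last (0, 0)%N t.

Definition is_tableau (n : nat) (la : tl_shape) (t : seq tl_shape) : bool :=
  [&& size t == n.+1,
      [forall k : 'I_n.+1, is_part k (nth (0, 0)%N t k)],
      nth (0, 0)%N t 0 == (0, 0)%N,
      [forall k : 'I_n, arrow (nth (0, 0)%N t k) (nth (0, 0)%N t k.+1)] &
      Shape t == la].

Record tableau (n : nat) (la : tl_partn n) :=
  Tableau { tseq :> seq tl_shape; _ : is_tableau n la tseq }.
HB.instance Definition _ n la := [isSub for @tseq n la].
HB.instance Definition _ n la := [Countable of @tableau n la by <:].

Section Finiteness.
Variable n : nat.
Implicit Type s : tl_shape.

Definition shape_enc s : 'I_n.+1 * 'I_n.+1 := (inord s.1, inord s.2).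
Definition shape_dec (u : 'I_n.+1 * 'I_n.+1) : tl_shape := (val u.1, val u.2).

Lemma shape_encK k s : (k <= n)%N -> is_part k s -> shape_dec (shape_enc s) = s.
Proof.
case: s => i j kn /eqP /= ijk; rewrite /shape_dec /= !inordK // ltnS.
  by rewrite (leq_trans _ kn) // -ijk leq_addl.
by rewrite (leq_trans _ kn) // -ijk mul2n -addnn -addnA leq_addr.
Qed.

Fact tl_partn_encK : pcancel (fun la : tl_partn n => shape_enc la)
                          (fun u => insub (shape_dec u)).
Proof.
by move=> la; rewrite (@shape_encK n) ?(valP la) // valK.
Qed.
HB.instance Definition _ : isFinite (tl_partn n) := PCanIsFinite tl_partn_encK.

Definition tab_enc (la : tl_partn n) (t : tableau la) :
  n.+1.-tuple ('I_n.+1 * 'I_n.+1) :=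
  [tuple shape_enc (nth (0, 0)%N t k) | k < n.+1].

Fact tab_encK la :
  pcancel (@tab_enc la) (fun u => insub (map shape_dec u)).
Proof.
move=> t; rewrite (_ : map _ _ = val t) ?valK //.
have /and5P[/eqP szt /forallP part_t _ _ _] := valP t.
apply: (@eq_from_nth _ (0, 0)%N); rewrite size_map size_tuple // => k ltkn.
rewrite (nth_map (0, 0)) ?size_tuple // -[k]/(val (Ordinal ltkn)).
rewrite -tnth_nth tnth_mktuple.
by apply: (@shape_encK k); last exact: (part_t (Ordinal ltkn)).
Qed.
HB.instance Definition _ la : isFinite (@tableau n la) :=
  PCanIsFinite (@tab_encK la).

End Finiteness.

Definition tab_dominates (n : nat) (la : tl_partn n) (s t : tableau la) : bool :=
  [forall k : 'I_n.+1,
    (0 < k)%N ==> dominates (Shape (restr k s)) (Shape (restr k t))].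
Definition tab_sdominates (n : nat) (la : tl_partn n) (s t : tableau la) : bool :=
  tab_dominates s t && (s != t).

(* From here on A is an R-algebra with a sequence e of elements; the statement
   takes those of A_n(x).  Then m_part la is m_la, ideal_part mu the ideal A_n^mu,
   ideal_above la their sum over the mu strictly dominating la, and cell la the
   right module C^la, with right action cell_act. *)
Section CellModule.
Variables (R : comNzRingType) (A : algType R) (e : nat -> A) (n : nat).
Implicit Types la mu : tl_partn n.

Definition m_part (la : tl_shape) : A := \prod_(0 <= j < la.1) e j.*2.+1.

Definition ideal_part mu : A -> Prop := ideal2 (fun a => a = m_part mu).

Definition ideal_above la : {pred A} := fun a =>
  `[< exists2 b : tl_partn n -> A,
        forall mu, sdominates mu la -> ideal_part mu (b mu) &
        a = \sum_(mu : tl_partn n | sdominates mu la) b mu >].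

Fact ideal_above_closed la : subsemimod_closed (ideal_above la).
Proof.
split; first split.
- apply/asboolP; exists (fun=> 0); last by rewrite big1.
  by move=> *; apply: ideal2_0.
- move=> _ _ /asboolP[b hb ->] /asboolP[c hc ->]; apply/asboolP.
  exists (fun mu => b mu + c mu); last by rewrite big_split.
  by move=> mu hmu; apply: ideal2_add; [apply: hb | apply: hc].
- move=> k _ /asboolP[b hb ->]; apply/asboolP.
  exists (fun mu => k *: b mu); last by rewrite scaler_sumr.
  by move=> mu hmu; apply: ideal2Z; apply: hb.
Qed.
HB.instance Definition _ la := GRing.isSubmodClosed.Build R A
  (ideal_above la) (ideal_above_closed la).

Lemma ideal_above_mulr la a b : a \in ideal_above la -> a * b \in ideal_above la.
Proof.
move=> /asboolP[c hc ->]; apply/asboolP; exists (fun mu => c mu * b).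
  by move=> mu hmu; apply: ideal2_mulr; apply: hc.
by rewrite mulr_suml.
Qed.

(* The right action of A on A / ideal_above la. *)
Definition qact la (c : quotmod (ideal_above la)) (b : A) :
  quotmod (ideal_above la) := qpi (ideal_above la) (qrepr c * b).

Lemma qactE la a b : qact (qpi (ideal_above la) a) b = qpi _ (a * b).
Proof. by apply/qpiP; rewrite -mulrBl ideal_above_mulr ?qpi_repr. Qed.

Lemma qactA la (c : quotmod (ideal_above la)) a b :
  qact (qact c a) b = qact c (a * b).
Proof. by rewrite -[c]qreprK !qactE mulrA. Qed.

Definition cell_pred la : {pred quotmod (ideal_above la)} := fun c =>
  `[< exists b : A, c = qact (qpi (ideal_above la) (m_part la)) b >].
Arguments cell_pred : clear implicits.

Fact cell_pred_closed la : subsemimod_closed (cell_pred la).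
Proof.
split; first split.
- by apply/asboolP; exists 0; rewrite qactE mulr0 qpi0.
- move=> _ _ /asboolP[a ->] /asboolP[b ->]; apply/asboolP; exists (a + b).
  by rewrite !qactE mulrDr qpiD.
- move=> k _ /asboolP[a ->]; apply/asboolP; exists (k *: a).
  by rewrite !qactE -scalerAr qpiZ.
Qed.
HB.instance Definition _ la := GRing.isSubmodClosed.Build R _
  (cell_pred la) (cell_pred_closed la).

Record cell la := Cell {
  cell_val : quotmod (ideal_above la);
  _ : cell_val \in cell_pred la }.
HB.instance Definition _ la := [isSub for @cell_val la].
HB.instance Definition _ la := [Choice of cell la by <:].
HB.instance Definition _ la := [SubChoice_isSubLmodule of cell la by <:].

Lemma cell_val0 la : @cell_val la 0 = 0.
Proof. exact: (raddf0 (val : cell la -> quotmod (ideal_above la))). Qed.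
Lemma cell_valD la : {morph @cell_val la : c d / c + d}.
Proof. exact: (raddfD (val : cell la -> quotmod (ideal_above la))). Qed.
Lemma cell_valZ la k (c : cell la) : cell_val (k *: c) = k *: cell_val c.
Proof. exact: (linearZ_LR (val : cell la -> quotmod (ideal_above la))). Qed.

Fact cell_act_subproof la (c : cell la) (b : A) :
  qact (cell_val c) b \in cell_pred la.
Proof.
have /asboolP[a ->] := valP c; apply/asboolP; exists (a * b).
by rewrite qactA.
Qed.
Definition cell_act la (c : cell la) (b : A) : cell la :=
  Cell (cell_act_subproof c b).

Definition tl_w (i j : nat) : A :=
  if (i < j)%N then \prod_(i <= k < j) e k
  else \prod_(k <- rev (index_iota j i)) e k.

(* k is the size of the tableau t.  As partitions of k - 1, the two candidates
   for the shape of restr (k - 1) t are told apart by their first component. *)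
Fixpoint tl_v (k : nat) (t : seq tl_shape) : A :=
  if k is k'.+1 then
    let f := (Shape t).1 in
    let s := restr k' t in
    if (Shape s).1 == f then tl_v k' s else tl_w f.*2 k * tl_v k' s
  else 1.

Fact m_tab_subproof la (t : tableau la) :
  qpi (ideal_above la) (m_part la * tl_v n t) \in cell_pred la.
Proof. by apply/asboolP; exists (tl_v n t); rewrite qactE. Qed.
Definition m_tab la (t : tableau la) : cell la := Cell (m_tab_subproof t).

End CellModule.

Section Elements.
Variables (R : comNzRingType) (x : R) (A : algType R) (e : nat -> A).

(* z_i as a function of the list s = [:: T_0; T_1; ...] of the T's *)
Definition tl_zsum (s : seq A) (i : nat) : A :=
  if (i < 2)%N then 0 else \sum_(0 <= k < i.+1) x ^+ k *: s`_(i - k).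

(* The list [:: T_0; ...; T_(m+2)] *)
Fixpoint tl_Tseq (m : nat) : seq A :=
  if m is m'.+1 then
    let s := tl_Tseq m' in
    let i := m'.+2 in
    rcons s (- (e i * s`_i) - s`_i * e i
             + e i * e i.-1 * s`_i * e i
             - tl_zsum s i.-1 - e i * tl_zsum s i.-2)
  else [:: 0; 0; e 1].

Definition tl_T (k : nat) : A := (tl_Tseq k)`_k.

Definition tl_z (i : nat) : A :=
  if (i < 2)%N then 0 else \sum_(0 <= k < i.+1) x ^+ k *: tl_T (i - k).

Lemma tl_T0 : tl_T 0 = 0. Proof. by []. Qed.
Lemma tl_T1 : tl_T 1 = 0. Proof. by []. Qed.
Lemma tl_T2 : tl_T 2 = e 1. Proof. by []. Qed.

Lemma size_tl_Tseq m : size (tl_Tseq m) = m.+3.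
Proof. by elim: m => //= m IHm; rewrite size_rcons IHm. Qed.

Lemma nth_tl_Tseq m k : (k < m.+3)%N -> (tl_Tseq m)`_k = tl_T k.
Proof.
have step j d : (j < d.+3)%N -> (tl_Tseq d.+1)`_j = (tl_Tseq d)`_j.
  by move=> hj; rewrite /= nth_rcons size_tl_Tseq hj.
have up j d d' : (j < d.+3)%N -> (d <= d')%N -> (tl_Tseq d')`_j = (tl_Tseq d)`_j.
  move=> hj /subnKC <-; elim: (d' - d)%N => [|c IHc]; first by rewrite addn0.
  rewrite addnS step ?IHc //; apply: leq_trans hj _.
  by rewrite !ltnS leq_addr.
move=> hk; rewrite /tl_T; case: (leqP m k) => [mk|/ltnW km].
  by rewrite (up k m k).
by rewrite (up k k m) // ltnS ltnW.
Qed.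

Lemma tl_TS i : (2 <= i)%N ->
  tl_T i.+1 = - (e i * tl_T i) - tl_T i * e i + e i * e i.-1 * tl_T i * e i
           - tl_z i.-1 - e i * tl_z i.-2.
Proof.
case: i => [|[|m]] // _; rewrite -(@nth_tl_Tseq m.+1) //.
have zE j : (j < m.+3)%N -> tl_zsum (tl_Tseq m) j = tl_z j.
  move=> hj; rewrite /tl_zsum /tl_z; case: ifP => [_|_]; first by [].
  apply: eq_bigr => k _.
  by rewrite nth_tl_Tseq // (leq_ltn_trans (leq_subr _ _) hj).
by rewrite /= nth_rcons size_tl_Tseq ltnn eqxx !nth_tl_Tseq // !zE // ltnW.
Qed.

End Elements.

Section Coefficients.
Variables (R : comNzRingType) (x : R).

Fixpoint tl_p (i : nat) : R :=
  match i with
  | 0 => 0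
  | 1 => 1
  | (i'.+1 as j).+1 => x * tl_p j - tl_p i'
  end.

(* k - i + 1 is written (k - i).+1; one always has i <= k here. *)
Definition tl_r (t : seq tl_shape) (k : nat) : R :=
  let i := (Shape (restr k t)).1 in
  if (k < 2)%N then 0
  else if (Shape (restr k.-1 t)).1.+1 == i
    then (tl_p i - x * tl_p i.-1) * tl_p (k - i).+1
    else (tl_p (k - i).+1 - x * tl_p (k - i)) * tl_p i.

End Coefficients.

(* The indeterminate of Z[x]. *)
Definition tl_x : {poly int} := 'X.

(* Main.v *)
(** The elements [z_k] commute with [e_1, ..., e_(k-1)] and satisfy
    [e_k z_(k+1) = e_k (z_(k-1) + p_(k+1))]; both facts come from one induction, which
    turns the definition of [T_k] into the three-term recursion [tl_central] below.
    A tableau of shape [(f, n-2f)] is a lattice word with [f] closing parentheses, so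
    [m_t] is the half-diagram with the corresponding cups, on which [e_i] acts by
    local moves, modulo diagrams with more than [f] cups.  Induction on [k] shows that
    [z_k] acts on [m_t] by [p_i p_(k-i+1)], where [Shape (t|_k) = (i, k-2i)], up to
    terms [m_v] with [v] dominating [t] and [Shape (v|_k)] strictly larger.
    Finally [T_k = z_k - x z_(k-1)]. *)
Require Import Defs.
From HB Require Import structures.
From mathcomp Require Import all_boot all_order all_algebra.
From mathcomp Require Import boolp zify ring.
From Stdlib Require Ncring Ncring_tac.

Set Implicit Arguments.
Unset Strict Implicit.
Unset Printing Implicit Defensive.

Import GRing.Theory.
Local Open Scope ring_scope.

(** * One step of the recursion, in a noncommutative ring *)

Section NoncommutativeRing.
Variable A : pzRingType.

#[local] Instance pzRing_ncring_ops :
  @Ncring.Ring_ops A 0%R 1%R +%R *%R (fun a b => a - b) -%R eq := {}.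

#[local] Instance pzRing_ncring :
  @Ncring.Ring _ _ _ _ _ _ _ _ pzRing_ncring_ops.
Proof.
split; try solve [exact _ | by intros ? ? -> ? ? -> | by intros ? ? ->].
- exact: add0r.
- exact: addrC.
- exact: addrA.
- exact: mul1r.
- exact: mulr1.
- exact: mulrA.
- exact: mulrDl.
- by move=> a b c; exact: mulrDr.
- by [].
- exact: subrr.
Qed.

(* Read [d], [e] as [e_(k-1)], [e_k]; [p], [q] as [p_(k-1)], [p_k]; and [y], [u], [v],
   [w] as [z_(k-2)], ..., [z_(k+1)]. *)
Variables (x p q d e y u : A).
Hypotheses (xC : forall a, a * x = x * a) (pC : forall a, a * p = p * a)
  (qC : forall a, a * q = q * a).
Hypotheses (dd : d * d = x * d) (ee : e * e = x * e)
  (ded : d * e * d = d) (ede : e * d * e = e)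
  (dy : d * y = y * d) (ey : e * y = y * e) (eu : u * e = e * u).

Let v := x * u - y - d * u - u * d + (x * y + p) * d.
Let w := x * v - u - e * v - v * e + (x * u + q) * e.

Hypotheses (dv : d * v = d * (y + q)).

(** Words are kept associated to the left, so each rule is listed alone and behind a prefix. Scalars
    move to the front, [y] before [d] and [e], and [e] before [u]. *)
Let far (a b : A) (ab : a * b = b * a) c : c * a * b = c * b * a.
Proof. by rewrite -!mulrA ab. Qed.
Let xR := (xC p, far (xC p), xC q, far (xC q), xC d, far (xC d),
  xC e, far (xC e), xC y, far (xC y), xC u, far (xC u)).
Let pR := (pC q, far (pC q), pC d, far (pC d), pC e, far (pC e),
  pC y, far (pC y), pC u, far (pC u)).
Let qR := (qC d, far (qC d), qC e, far (qC e), qC y, far (qC y), qC u, far (qC u)).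
Let ddA a : a * d * d = a * x * d. Proof. by rewrite -!mulrA dd. Qed.
Let eeA a : a * e * e = a * x * e. Proof. by rewrite -!mulrA ee. Qed.
Let dedA a : a * d * e * d = a * d. Proof. by rewrite -!mulrA (mulrA d) ded. Qed.
Let edeA a : a * e * d * e = a * e. Proof. by rewrite -!mulrA (mulrA e) ede. Qed.
Let dyA a : a * d * y = a * y * d. Proof. by rewrite -!mulrA dy. Qed.
Let eyA a : a * e * y = a * y * e. Proof. by rewrite -!mulrA ey. Qed.
Let euA a : a * u * e = a * e * u. Proof. by rewrite -!mulrA eu. Qed.

(** A completion rule: ordering [u * e] as [e * u] hides the pattern [e * d * e]. *)
Let eude : e * u * d * e = e * u.
Proof. by rewrite -eu -[LHS]mulrA -[LHS]mulrA (mulrA e) ede. Qed.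
Let eudeA a : a * e * u * d * e = a * e * u.
Proof. by rewrite -[a * e * u]mulrA -eude !mulrA. Qed.

Let rules := (xR, pR, qR, dd, ee, ded, ede, dy, ey, eu,
  ddA, eeA, dedA, edeA, dyA, eyA, euA, eude, eudeA).
Let expand := (mulrDl, mulrDr, mulNr, mulrN, mulrA).

(** Since [x * q - p] is p_(k+1), this absorption rule is the next instance of [dv]. *)
Lemma central_step_mull : e * w = e * (u + (x * q - p)).
Proof. by rewrite /w /v !expand !rules; Ncring_tac.non_commutative_ring. Qed.

Lemma central_step_mulr : w * e = (u + (x * q - p)) * e.
Proof. by rewrite /w /v !expand !rules; Ncring_tac.non_commutative_ring. Qed.

Lemma central_step_comm : d * w = w * d.
Proof.
(* [rules] do not reduce the word [d * u * d]; its value comes from expanding [dv] and solving for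
   it. *)
have dud : d * u * d = x * x * y * d + x * p * d - y * d - y * d - q * d.
  move: dv; rewrite /v !expand !rules => /eqP; rewrite -subr_eq0 => /eqP dv0.
  apply/eqP; rewrite -subr_eq0 -oppr_eq0 -dv0; apply/eqP.
  by Ncring_tac.non_commutative_ring.
have dudA c : c * d * u * d = c * (d * u * d) by rewrite !mulrA.
by rewrite /w /v !expand !rules !dudA !dud !expand !rules;
  Ncring_tac.non_commutative_ring.
Qed.

(** With [v - x * u] for T_k, the left side is the defining recursion of T_(k+1); [dv] absorbs the
    z_k in e_k e_(k-1) T_k e_k. *)
Lemma central_step_T :
  - (e * (v - x * u)) - (v - x * u) * e + e * d * (v - x * u) * e - u - e * y
  = w - x * v.
Proof.
have -> : e * d * (v - x * u) * e = e * (d * (y + q)) * e - e * d * x * u * e.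
  by rewrite -dv mulrBr mulrBl !mulrA.
by rewrite /w /v !expand !rules; Ncring_tac.non_commutative_ring.
Qed.

Lemma central_step_act (m g h : A) : (forall a, a * g = g * a) -> (forall a, a * h = h * a) ->
  m * (x * u - y - e * u - u * e + (x * y + q) * e) - (x * g - h) * m =
  x * (m * u - g * m) - (m * y - h * m) - m * e * u - (m * u - g * m) * e
  + x * (m * y - h * m) * e + (x * h + q - g) * (m * e).
Proof.
move=> gC hC; rewrite !expand (xC m) (qC m).
Ncring_tac.non_commutative_ring.
Qed.
End NoncommutativeRing.

(** * Centrality of z_k *)

Section TLRelations.
Variables (R : comNzRingType) (x : R) (A : algType R) (e : nat -> A) (n : nat).

Definition TL_relations :=
  [/\ forall i, e i * e i = x *: e i,
      forall i j, (0 < i < n)%N -> (0 < j < n)%N ->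
        (i == j.+1) || (j == i.+1) -> e i * e j * e i = e i &
      forall i j, (i.+1 < j)%N || (j.+1 < i)%N -> e i * e j = e j * e i].

Hypothesis eP : TL_relations.

Let e_sq i : e i * e i = x *: e i. Proof. by case: eP. Qed.
Let e_comm i j : (i.+1 < j)%N || (j.+1 < i)%N -> e i * e j = e j * e i.
Proof. by case: eP => _ _; exact. Qed.
Lemma e_up i : (0 < i)%N -> (i.+1 < n)%N -> e i * e i.+1 * e i = e i.
Proof. by move=> i0 iN; case: eP => _ braid _; apply: braid; lia. Qed.
Lemma e_down i : (0 < i)%N -> (i.+1 < n)%N -> e i.+1 * e i * e i.+1 = e i.+1.
Proof. by move=> i0 iN; case: eP => _ braid _; apply: braid; lia. Qed.

Local Notation p := (tl_p x).

Lemma tl_pSS i : p i.+2 = x * p i.+1 - p i. Proof. by []. Qed.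

(** An addition formula for Chebyshev polynomials of the second kind. It matches eigenvalues with
    absorption: one more cup turns p_i p_(k-i+1) into p_(i+1) p_(k-i+2), which is larger by
    p_(k+2). *)
Lemma tl_p_cross a b : p a.+1 * p b.+1 = p a * p b + p (a + b).+1.
Proof.
suff: p a.+1 * p b.+1 = p a * p b + p (a + b).+1 /\
      p a.+2 * p b.+1 = p a.+1 * p b + p (a + b).+2 by case.
elim: a => [|a [IH1 IH2]]; first by rewrite !add0n !tl_pSS /=; split; ring.
split; first by rewrite IH2 addSn.
have -> : p (a.+1 + b).+2 = x * p (a + b).+2 - p (a + b).+1 by rewrite addSn tl_pSS.
have -> : p (a + b).+2 = p a.+2 * p b.+1 - p a.+1 * p b by rewrite IH2; ring.
have -> : p (a + b).+1 = p a.+1 * p b.+1 - p a * p b by rewrite IH1; ring.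
by rewrite !(tl_pSS a.+1) !(tl_pSS a); ring.
Qed.

(* This is [tl_z] without the term [e_k e_(k-1) T_k e_k] of the original recursion;
   they agree on [k <= n] by [tl_TE]. *)
Fixpoint tl_central (k : nat) : A :=
  match k with
  | 0 => 0
  | 1 => 0
  | (k'.+1 as j).+1 => x *: tl_central j - tl_central k'
      - e j * tl_central j - tl_central j * e j
      + (x *: tl_central k' + (p j)%:A) * e j
  end.
Local Notation Y := tl_central.

Lemma tl_centralSS k : Y k.+2 = x *: Y k.+1 - Y k - e k.+1 * Y k.+1
  - Y k.+1 * e k.+1 + (x *: Y k + (p k.+1)%:A) * e k.+1.
Proof. by []. Qed.

Lemma tl_central2 : Y 2 = e 1.
Proof. by rewrite /= !(scaler0, mulr0, mul0r, oppr0, addr0, add0r) scale1r mul1r. Qed.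

Lemma commr_alg (c : R) (a : A) : a * c%:A = c%:A * a.
Proof. by rewrite mulr_algr mulr_algl. Qed.

(** z_k is a polynomial in e_1, ..., e_(k-1), which all commute with e_j. *)
Lemma tl_central_comm_gt k j : (k < j)%N -> e j * Y k = Y k * e j.
Proof.
suff : (k < j)%N -> GRing.comm (e j) (Y k) /\ GRing.comm (e j) (Y k.-1) by move=> H /H[].
case: k => [|k]; first by move=> _; split; exact: commr0.
elim: k => [|k IH] kj; first by split; exact: commr0.
have [|IH1 IH0] := IH; first by lia.
split=> //; rewrite tl_centralSS.
have ee : GRing.comm (e j) (e k.+1) by apply: e_comm; lia.
have c1 c a : GRing.comm (e j) a -> GRing.comm (e j) (c *: a).
  by rewrite /GRing.comm -scalerAr -scalerAl => ->.
by repeat (assumption || apply: commrD || apply: commrN || apply: c1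
  || apply: commrM || exact: commr1).
Qed.

(** The clauses feed each other: [central_step_comm] needs the absorption rule one step earlier, and
    the two absorption rules give commutation with the last generator. *)
Lemma tl_central_spec k : (k < n)%N ->
  [/\ forall j, (0 < j <= k)%N -> e j * Y k.+1 = Y k.+1 * e j,
      (0 < k)%N -> e k * Y k.+1 = e k * (Y k.-1 + (p k.+1)%:A) &
      (0 < k)%N -> Y k.+1 * e k = (Y k.-1 + (p k.+1)%:A) * e k].
Proof.
elim/ltn_ind: k => -[|[|k]] IH kn.
- by split=> // j; lia.
  rewrite tl_central2 /= mulr1 subr0 add0r; split=> [j j1|_|_].
  + by have -> : j = 1%N by lia.
  + by rewrite e_sq mulr_algr.
  + by rewrite e_sq mulr_algl.
have [cY eY Ye] := IH k.+1 (leqnn _) (ltnW kn).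
have [cY' _ _] := IH k (ltnW (leqnn _)) (ltn_trans (ltnW (leqnn _)) kn).
have h := @central_step_mull A x%:A (p k.+1)%:A (p k.+2)%:A (e k.+1) (e k.+2) (Y k) (Y k.+1).
have h' := @central_step_mulr A x%:A (p k.+1)%:A (p k.+2)%:A (e k.+1) (e k.+2) (Y k) (Y k.+1).
have h'' := @central_step_comm A x%:A (p k.+1)%:A (p k.+2)%:A (e k.+1) (e k.+2) (Y k) (Y k.+1).
have pE : x%:A * (p k.+2)%:A - (p k.+1)%:A = (p k.+3)%:A :> A.
  by rewrite mulr_algl scalerA -scalerBl.
rewrite pE !mulr_algl -!tl_centralSS in h h' h''.
have eL : e k.+2 * Y k.+3 = e k.+2 * (Y k.+1 + (p k.+3)%:A).
  apply: h; rewrite ?e_sq ?e_up ?e_down ?tl_central_comm_gt //.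
  all: try exact: commr_alg.
  all: try lia.
have eR : Y k.+3 * e k.+2 = (Y k.+1 + (p k.+3)%:A) * e k.+2.
  apply: h'; rewrite ?e_sq ?e_up ?e_down ?tl_central_comm_gt //.
  all: try exact: commr_alg.
  all: try lia.
split=> // j jk.
(* For j = k+2 use both absorption rules, for j = k+1 [central_step_comm]; a smaller e_j commutes
   with every term of the recursion. *)
case: (ltngtP j k.+2) => [jlt||->]; first last.
- by rewrite eL eR mulrDl mulrDr commr_alg tl_central_comm_gt.
- by lia.
case: (ltngtP j k.+1) => [jlt'||->]; first last.
- apply: h''; rewrite ?e_sq ?e_up ?e_down ?eY ?tl_central_comm_gt //.
  all: try exact: commr_alg.
  all: try lia.
  all: try lia.
rewrite [Y k.+3]tl_centralSS.
have ee : GRing.comm (e j) (e k.+2) by apply: e_comm; lia.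
have c1 c a : GRing.comm (e j) a -> GRing.comm (e j) (c *: a).
  by rewrite /GRing.comm -scalerAr -scalerAl => ->.
have y1 : GRing.comm (e j) (Y k.+2) by apply: cY; lia.
have y2 : GRing.comm (e j) (Y k.+1) by apply: cY'; lia.
by repeat (assumption || apply: commrD || apply: commrN || apply: c1
  || apply: commrM || exact: commr1).
Qed.

(** Since z_(i+1) = T_(i+1) + x z_i, only the formula for T needs work; its inductive step is
    [central_step_T]. *)
Lemma tl_TE k : (k < n)%N -> tl_T x e k.+1 = Y k.+1 - x *: Y k /\ tl_z x e k.+1 = Y k.+1.
Proof.
have zS i : tl_z x e i.+1 = tl_T x e i.+1 + x *: tl_z x e i.
  case: i => [|[|i]].
  - by rewrite /tl_z /= scaler0 addr0.
  - by rewrite /tl_z /= scaler0 addr0 unlock /= !scaler0 expr0 scale1r !addr0.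
  rewrite [LHS]/tl_z /= big_nat_recl // expr0 scale1r subn0; congr (_ + _).
  rewrite /tl_z /= scaler_sumr; apply: eq_bigr => j _.
  by rewrite subSS exprS scalerA.
elim/ltn_ind: k => -[|[|k]] IH kn.
- by rewrite /tl_z /= tl_T1 scaler0 subr0.
- by rewrite zS tl_T2 /tl_z [(1 < 2)%N]/= [Y 1]/= tl_central2 scaler0 subr0 addr0.
have [T2 z2] := IH k.+1 (leqnn _) (ltnW kn).
have [_ z1] := IH k (ltnW (leqnn _)) (ltn_trans (ltnW (leqnn _)) kn).
have z0 : tl_z x e k = Y k.
  case: (k) IH kn => [//|k'] IH kn.
  have [||//] := IH k'; lia.
suff TE : tl_T x e k.+3 = Y k.+3 - x *: Y k.+2.
  by split=> //; rewrite zS TE z2 subrK.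
have [_ eY _] := tl_central_spec (ltnW kn).
have h := @central_step_T A x%:A (p k.+1)%:A (p k.+2)%:A (e k.+1) (e k.+2) (Y k) (Y k.+1).
rewrite !mulr_algl -!tl_centralSS in h.
rewrite tl_TS // [k.+2.-1]/= [k.+2.-2]/= T2 z1 z0; apply: h.
all: rewrite ?e_sq ?e_up ?e_down ?eY ?tl_central_comm_gt //.
all: try exact: commr_alg.
all: try lia.
Qed.
End TLRelations.

(** * Lattice words and half-diagrams *)

(* [c j] is the first component of the shape at step [j]; there is no upper bound on
   [j], although only [j <= n] matters. *)
Definition height (c : nat -> nat) : Prop :=
  c 0 = 0%N /\ forall j, [&& c j <= c j.+1, c j.+1 <= (c j).+1 & (c j).*2 <= j]%N.

(* Letters [i+1] and [i+2] are an opening and a closing parenthesis. *)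
Definition cup (c : nat -> nat) (i : nat) : bool :=
  (c i.+1 == c i) && (c i.+2 == (c i).+1).

(* At a [cup] [i], [flip c i.+1] exchanges letters [i+1] and [i+2]. *)
Definition flip (c : nat -> nat) (i : nat) : nat -> nat :=
  [eta c with i |-> (c i).+1].

Lemma flipE c i j : flip c i j = if j == i then (c i).+1 else c j.
Proof. by []. Qed.

Lemma height_step c : height c -> forall j, 
  (c j <= c j.+1)%N /\ (c j.+1 <= (c j).+1)%N /\ ((c j).*2 <= j)%N.
Proof. by case=> _ H j; have /and3P[] := H j. Qed.

Lemma height_homo c i j : height c -> (i <= j)%N -> (c i <= c j)%N.
Proof.
move=> cP /subnKC <-; elim: (j - i)%N => [|d IH]; first by rewrite addn0.
by rewrite addnS (leq_trans IH) //; case: (height_step cP (i + d)).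
Qed.

Lemma height_flip c i : height c -> cup c i -> ((c i).+1.*2 <= i.+1)%N ->
  height (flip c i.+1).
Proof.
move=> cP /andP[/eqP c1 /eqP c2] ci; split; first by case: cP.
move=> j; have := height_step cP j; rewrite !flipE eqSS.
case: (j =P i) => [->|ji]; first by rewrite ltn_eqF //; lia.
by case: (j =P i.+1) => [->|ji']; lia.
Qed.

(** The inverse of a flip: a closing letter followed by an opening one is turned into a cup. *)
Lemma height_lower c i : height c -> c i.+1 = (c i).+1 -> c i.+2 = c i.+1 ->
  height [eta c with i.+1 |-> c i].
Proof.
move=> cP c1 c2; split; first by case: cP.
move=> j; have := height_step cP j; have := height_step cP i => /=; rewrite eqSS.
case: (j =P i) => [->|ji]; first by rewrite ltn_eqF //; lia.
by case: (j =P i.+1) => [->|ji']; lia.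
Qed.

(** The run of closing letters ending at letter m+1 cannot start the word, so an opening letter
    precedes it. The last equation says that letters l+2 to m+1 all close. *)
Lemma last_cup c m : height c -> c m.+1 = (c m).+1 ->
  exists l, [/\ cup c l, (l < m)%N & c m.+1 = c l + (m - l)]%N.
Proof.
move=> cP; elim: m => [|m IH] cm.
  by have := height_step cP 1; lia.
have [c1|c1] := eqVneq (c m.+1) (c m).
  by exists m; rewrite /cup c1 cm; split; lia.
have [|l [cl lm cE]] := IH; first by have := height_step cP m; lia.
by exists l; split=> //; lia.
Qed.

(** The first closing letter after step i forms a cup with the opening letter before it. *)
Lemma first_cup c i n : height c -> c i.+2 = c i -> c n != c i -> (i <= n)%N ->
  exists l, [/\ cup c l, (i < l)%N, (l.+2 <= n)%N & c l = c i].
Proof.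
move=> cP c2 cn iN.
have /ex_minnP[m /andP[im cm] mP] : exists m, (i <= m)%N && (c m != c i).
  by exists n; rewrite iN.
have mn : (m <= n)%N by apply: mP; rewrite iN.
have same j : (i <= j)%N -> (j < m)%N -> c j = c i.
  move=> ij jm; apply/eqP; apply: contraTT jm => cj.
  by rewrite -leqNgt; apply: mP; rewrite ij.
have i2m : (i.+2 < m)%N.
  rewrite ltnNge; apply: contra cm => mi.
  by rewrite eqn_leq -{1}c2 !height_homo.
case: m i2m {mP} mn im cm same => [//|[//|l]] i2m mn im cm same.
exists l; have cl : c l = c i by apply: same; lia.
have cl1 : c l.+1 = c i by apply: same; lia.
have := height_step cP l.+1; rewrite /cup cl cl1.
by split=> //; lia.
Qed.

Section HalfDiagrams.
Variables (R : comNzRingType) (x : R) (A : algType R) (e : nat -> A) (n : nat).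
Hypothesis eP : TL_relations x e n.

Let e_comm i j : (i.+1 < j)%N || (j.+1 < i)%N -> e i * e j = e j * e i.
Proof. by case: eP => _ _; exact. Qed.

(* [m_lambda v_t] with each factor [w_(2f,n)] moved to the left of [m], where it becomes
   [w_(2f-1,n)]. *)
Fixpoint hdiag (c : nat -> nat) (k : nat) : A :=
  if k is k'.+1 then
    if c k == c k' then hdiag c k'
    else (\prod_((c k').*2.+1 <= j < k) e j) * hdiag c k'
  else 1.

Lemma hdiagS c k : hdiag c k.+1 =
  if c k.+1 == c k then hdiag c k
  else (\prod_((c k).*2.+1 <= j < k.+1) e j) * hdiag c k.
Proof. by []. Qed.

Lemma hdiag_ext c c' k : (forall j, (j <= k)%N -> c j = c' j) ->
  hdiag c k = hdiag c' k.
Proof.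
elim: k => //= k IH cc'; rewrite !cc' // IH // => j jk.
by apply: cc'; lia.
Qed.

(** Later letters multiply on the left, so an identity for a right action at step k survives to step
    m. *)
Lemma hdiag_extend c c' k m (a b : A) : (k <= m)%N ->
  (forall j, (k <= j)%N -> c j = c' j) ->
  hdiag c k * a = hdiag c' k * b -> hdiag c m * a = hdiag c' m * b.
Proof.
move=> /subnKC <- cc' ab; elim: (m - k)%N => [|d IH]; first by rewrite addn0.
rewrite addnS !hdiagS !cc' ?leqW ?leq_addr //.
by case: eqP => // _; rewrite -!mulrA IH.
Qed.

Lemma comm_prod_nat (a : A) (F : nat -> A) i k :
  (forall j, (i <= j < k)%N -> a * F j = F j * a) ->
  a * (\prod_(i <= j < k) F j) = (\prod_(i <= j < k) F j) * a.
Proof. by move=> aF; rewrite big_nat; apply: commr_prod. Qed.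

Lemma hdiag_comm c k i : (k < i)%N -> e i * hdiag c k = hdiag c k * e i.
Proof.
elim: k => [|k IH] ki /=; first by rewrite mulr1 mul1r.
case: eqP => _; first by apply: IH; lia.
rewrite -[RHS]mulrA -IH ?mulrA; last by lia.
by congr (_ * _); apply: comm_prod_nat => j jk; apply: e_comm; lia.
Qed.

(** The factor of the closing letter i+2 ends in e_(i+1), which commutes past [hdiag c i]. *)
Lemma cup_factor c i k : height c -> cup c i -> (i.+2 <= k)%N ->
  exists g, hdiag c k = g * e i.+1.
Proof.
move=> cP /andP[/eqP c1 /eqP c2] /subnKC <-; elim: (k - _)%N => [|d [g IH]].
  rewrite addn0 /= c2 !c1 eqxx gtn_eqF // big_nat_recr /=; last first.
    by have := height_step cP i; lia.
  by rewrite -mulrA hdiag_comm // mulrA; eexists.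
by rewrite addnS hdiagS IH; case: eqP => _; [exists g | rewrite mulrA; eexists].
Qed.

(** Flipping shortens the factor of the closing letter by exactly its last generator e_(i+1). *)
Lemma flip_act c i k : height c -> cup c i -> (i.+2 <= k)%N ->
  hdiag (flip c i.+1) k * e i.+1 = hdiag c k.
Proof.
move=> cP /andP[/eqP c1 /eqP c2] ik; rewrite -[RHS]mulr1.
apply: (hdiag_extend ik) => [j ij|]; first by rewrite flipE ifN //; lia.
rewrite mulr1 !hdiagS !flipE eqxx c2 !c1 eqxx [i.+2 == _]gtn_eqF //.
rewrite [i == _]ltn_eqF // eqxx [(c i).+1 == _]gtn_eqF //.
rewrite [X in _ = X * _]big_nat_recr /=; last by have := height_step cP i; lia.
rewrite -!mulrA [e i.+1 * hdiag c i]hdiag_comm //; congr (_ * (_ * _)).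
by apply: hdiag_ext => j ji; rewrite flipE ifN //; lia.
Qed.

(** Straightening a zigzag: open, open, close becomes open, close, open, by the relation e_(i+1)
    e_(i+2) e_(i+1) = e_(i+1). *)
Lemma flip_UUD c i k : height c -> c i.+1 = c i -> cup c i.+1 -> (i.+3 <= k)%N ->
  (k <= n)%N -> hdiag c k * e i.+1 = hdiag (flip c i.+2) k.
Proof.
move=> cP c1 cu ik kn; rewrite -(flip_act cP cu ik).
have [||g ->] := @cup_factor (flip c i.+2) i k _ _ (ltnW ik).
- by apply: height_flip => //; have := height_step cP i; lia.
- by move: cu; rewrite /cup !flipE !eqxx !ifN //; lia.
by rewrite -!mulrA (mulrA (e i.+1)) (e_up eP) //; lia.
Qed.

Lemma flip_UDD c i k : height c -> cup c i -> c i.+3 = (c i).+2 -> (i.+3 <= k)%N ->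
  (k <= n)%N -> hdiag c k * e i.+2 = hdiag (flip c i.+1) k.
Proof.
move=> cP cu c3 ik kn; rewrite -(flip_act cP cu (ltnW ik)).
have [||g ->] := @cup_factor (flip c i.+1) i.+1 k _ _ ik.
- by apply: height_flip => //; have := height_step cP i.+3; lia.
- by move: cu; rewrite /cup !flipE !eqxx !ifN //; lia.
by rewrite -!mulrA (mulrA (e i.+2)) (e_down eP) //; lia.
Qed.

Lemma m_partS f g h : m_part e (f.+1, g) = m_part e (f, h) * e f.*2.+1.
Proof. by rewrite /m_part big_nat_recr. Qed.

Lemma m_part_comm f g i : (f.*2 < i)%N ->
  e i * m_part e (f, g) = m_part e (f, g) * e i.
Proof.
elim: f g => [|f IH] g fi; first by rewrite /m_part big_geq // mulr1 mul1r.
rewrite (m_partS f g g) mulrA IH -?mulrA; last by lia.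
by congr (_ * _); apply: e_comm; lia.
Qed.

(** The relation e_(j+1) = e_(j+1) e_j e_(j+1) lowers i to 2f+1, where m_f e_(2f+1) = m_(f+1). *)
Lemma e_m_part f g h i : (f.*2 < i)%N -> (i < n)%N ->
  exists a b, e i * m_part e (f, g) = a * m_part e (f.+1, h) * b.
Proof.
move=> /subnKC <-; elim: (i - _)%N => [|d IH] fn.
  exists 1, 1; rewrite addn0 mul1r mulr1 (m_partS f h g) m_part_comm //.
have [|a [b ab]] := IH; first by lia.
have -> : e (f.*2.+1 + d.+1) = e (f.*2.+1 + d.+1) * e (f.*2.+1 + d) * e (f.*2.+1 + d.+1).
  by rewrite addnS (e_down eP) //; lia.
rewrite -!mulrA m_part_comm; last by lia.
rewrite (mulrA (e (_ + d))) ab.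
by exists (e (f.*2.+1 + d.+1) * a), (b * e (f.*2.+1 + d.+1)); rewrite !mulrA.
Qed.

(** The first generator e_(2f-1) of a closing factor turns m_(f-1) into m_f; the rest is w_(2f,k+1)
    and commutes with m_(f-1). *)
Lemma hdiag_tl_v c k t g : height c -> size t = k.+1 ->
  (forall j, (j <= k)%N -> (nth (0, 0)%N t j).1 = c j) ->
  hdiag c k = m_part e (c k, g) * tl_v e k t.
Proof.
move=> cP; elim: k t => [|k IH] t tk tc.
  by rewrite /m_part; have [-> _] := cP; rewrite big_geq // mulr1.
have tE m : (m < k.+2)%N -> (Shape (restr m t)).1 = c m.
  by move=> mk; rewrite /Shape /restr -nth_last size_takel ?tk // nth_take // tc.
have SE : (Shape t).1 = c k.+1 by rewrite -tE // /restr take_oversize // tk.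
rewrite /= SE tE //; have {IH}IH : hdiag c k = m_part e (c k, g) * tl_v e k (restr k t).
  apply: IH => [|j jk]; first by rewrite /restr size_take tk ltnS leqnn.
  by rewrite nth_take // tc // leqW.
rewrite [X in if X then _ else _ * _]eq_sym; case: eqP => [<-|cne]; first exact: IH.
have c1 : c k.+1 = (c k).+1 by have := height_step cP k; lia.
have ck : ((c k).*2.+2 <= k.+1)%N by have := height_step cP k.+1; lia.
rewrite IH c1 (m_partS _ _ g) big_ltn; last by lia.
(* [tl_w] reaches its second branch only when 2f = k+1, and is then empty. *)
have -> : tl_w e (c k).+1.*2 k.+1 = \prod_((c k).*2.+2 <= j < k.+1) e j.
  rewrite /tl_w doubleS; case: ifP => // kc.
  have -> : (c k).*2.+2 = k.+1 by lia.
  by rewrite big_geq // /index_iota subnn big_nil.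
rewrite -[m_part _ _ * e _]m_part_comm // -!mulrA; congr (_ * _).
rewrite !mulrA; congr (_ * _).
symmetry; apply: comm_prod_nat => j jk; rewrite m_part_comm //; lia.
Qed.

End HalfDiagrams.

(** * Triangularity *)

(** A measure for the inductions that move to more dominant words. *)
Definition deficit (n : nat) (c : nat -> nat) : nat := (\sum_(j < n.+1) (n - c j))%N.

Lemma deficit_lt n c c' l : (forall j, (c j <= c' j)%N) -> (c l < c' l)%N ->
  (l <= n)%N -> (c' l <= n)%N -> (deficit n c' < deficit n c)%N.
Proof.
move=> cc' ll ln cn; have ln' : (l < n.+1)%N by [].
rewrite /deficit (bigD1 (Ordinal ln')) //= [ltnRHS](bigD1 (Ordinal ln')) //=.
rewrite -addSn leq_add //; first by lia.
by apply: leq_sum => j _; apply: leq_sub2l.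
Qed.

(** Distinct cups occupy disjoint pairs of letters. *)
Lemma cup_flip c l k : cup c l -> cup c k -> k != l -> cup (flip c l.+1) k.
Proof.
rewrite /cup => /andP[/eqP l1 /eqP l2] /andP[/eqP k1 /eqP k2] kl.
have [E|?] := eqVneq k l.+1; first by subst; lia.
have [E|?] := eqVneq k.+1 l; first by subst; lia.
by rewrite !flipE !ifN ?k1 ?k2 ?eqxx //; lia.
Qed.

Section Span.
Variables (R : comNzRingType) (x : R) (A : algType R) (e : nat -> A) (n f : nat).
Hypothesis eP : TL_relations x e n.

Let e_comm i j : (i.+1 < j)%N || (j.+1 < i)%N -> e i * e j = e j * e i.
Proof. by case: eP => _ _; exact. Qed.

Implicit Types (P Q : (nat -> nat) -> Prop) (c u : nat -> nat).

(* The guard on [hspan_ideal] makes (f+1, n-2f-2) a partition of n. *)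
Inductive hspan P : A -> Prop :=
| hspan0 : hspan P 0
| hspan_ideal a b of (f.+1.*2 <= n)%N : hspan P (a * m_part e (f.+1, 0%N) * b)
| hspan_hdiag c of height c & c n = f & P c : hspan P (hdiag e c n)
| hspanD a b of hspan P a & hspan P b : hspan P (a + b)
| hspanZ k a of hspan P a : hspan P (k *: a).

Lemma hspanN P a : hspan P a -> hspan P (- a).
Proof. by rewrite -scaleN1r; apply: hspanZ. Qed.

Lemma hspanB P a b : hspan P a -> hspan P b -> hspan P (a - b).
Proof. by move=> Pa Pb; apply: hspanD => //; apply: hspanN. Qed.

Lemma hspan_mulr P Q a b : hspan P a ->
  (forall c, height c -> c n = f -> P c -> hspan Q (hdiag e c n * b)) ->
  hspan Q (a * b).
Proof.
move=> Pa PQ; elim: Pa => [|a1 a2 fn|c cP cn Pc|a1 a2 _ IH1 _ IH2|k a1 _ IH].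
- by rewrite mul0r; apply: hspan0.
- by rewrite -mulrA; apply: hspan_ideal.
- exact: PQ.
- by rewrite mulrDl; apply: hspanD.
- by rewrite -scalerAl; apply: hspanZ.
Qed.

Lemma hspan_sub P Q a : (forall c, height c -> c n = f -> P c -> Q c) ->
  hspan P a -> hspan Q a.
Proof.
move=> PQ Pa; rewrite -[a]mulr1; apply: hspan_mulr Pa _ => c cP cn Pc.
by rewrite mulr1; apply: hspan_hdiag => //; apply: PQ.
Qed.

(** The invariant of words [u] produced by e_(i+1) from [c]. Step i+1 is exempt from the order
    because a close-open pair becomes a cup there. The last clause lets a distant generator act
    afterwards without destroying the cup at i. *)
Definition reach c i u : Prop :=
  [/\ forall j, j != i.+1 -> (c j <= u j)%N, cup u i &
      forall l, (l.+1 < i)%N || (i.+1 < l)%N -> cup c l -> cup u l].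

(** Induction on the deficit, by the letters i+1 and i+2. A cup closes a loop; close-open becomes a
    cup by [flip_act]. If both open, the next cup to the right is used, if both close, the last one
    to the left: it gives a zigzag when adjacent and is treated by [far] otherwise. *)
Lemma hdiag_act c i : height c -> c n = f -> (i.+1 < n)%N ->
  hspan (reach c i) (hdiag e c n * e i.+1).
Proof.
have [m] := ubnP (deficit n c).
elim: m c i => // m IH c i cm cP cn iN.
have s0 := height_step cP i; have s1 := height_step cP i.+1.
(* Here [hdiag c = hdiag (flip c l.+1) * e l.+1] with [flip c l.+1] more dominant,
     and [e l.+1] commutes with [e i.+1]. *)
have far l : cup c l -> (l.+2 <= n)%N -> ((c l).+1.*2 <= l.+1)%N ->
    (l.+1 < i)%N || (i.+1 < l)%N ->
    (forall u, height u -> reach (flip c l.+1) i u -> (c i.+1 <= u i.+1)%N) ->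
    hspan (reach c i) (hdiag e c n * e i.+1).
  move=> cl lN cl2 li keep; have fP := height_flip cP cl cl2.
  have /andP[/eqP cl1 /eqP cl2'] := cl.
  rewrite -(flip_act eP cP cl lN) -mulrA e_comm; last by lia.
  rewrite mulrA.
  have fn : flip c l.+1 n = f by rewrite flipE ifN //; lia.
  have lt_def u : (forall j, (flip c l.+1 j <= u j)%N) -> height u ->
      (deficit n u < m)%N.
    move=> cu uP; apply: leq_trans (_ : deficit n c <= m)%N; last by lia.
    apply: (@deficit_lt _ _ _ l.+1); last 2 first.
    - by lia.
    - by have := height_step uP l.+1; lia.
    - by move=> j; apply: leq_trans (cu j); rewrite flipE; case: eqP => // ->.
    - by have := cu l.+1; rewrite flipE eqxx; lia.
  have := IH _ i (lt_def _ (fun=> leqnn _) fP) fP fn iN.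
  move=> /hspan_mulr; apply => u uP un ru; have [uc ui ul] := ru.
  have cu j : (flip c l.+1 j <= u j)%N.
    have [->|] := eqVneq j i.+1; last exact: uc.
    by rewrite flipE ifN ?(keep u) //; lia.
  apply: hspan_sub (IH u l (lt_def u cu uP) uP un lN) => v vP vn [vu vl vfar].
  split=> [j ji||k ki ck].
  (* Only step l+1 is unconstrained; there the cup at l gives v(l+1) = v(l) >= c(l) = c(l+1). *)
  - have [->|jl] := eqVneq j l.+1.
      move: vl => /andP[/eqP -> _]; rewrite cl1.
      have -> : c l = flip c l.+1 l by rewrite flipE ifN //; lia.
      by apply: leq_trans (cu l) (vu _ _); lia.
    apply: leq_trans (vu _ jl); apply: leq_trans (cu j).
    by rewrite flipE (negPf jl).
  - by apply: vfar => //; lia.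
  have [->//|kl] := eqVneq k l.
  have kl' := cup_flip cl ck kl.
  apply: vfar; last exact: ul.
  move: cl ck kl; rewrite /cup; case: (eqVneq k l.+1) => [->|k1]; first by lia.
  by case: (eqVneq k.+1 l) => [<-|k2]; lia.
have [c1|c1] := eqVneq (c i.+1) (c i).
  have [c2|c2] := eqVneq (c i.+2) (c i).
    (* If no letter closes after step i, then e_(i+1) moves left onto m_f and produces an element of
       the ideal of m_(f+1). *)
    have [cc|cc] := eqVneq (c n) (c i).
      have const j : (i <= j <= n)%N -> c j = c i.
        move=> /andP[ij jn]; apply/eqP; rewrite eqn_leq (height_homo cP ij) andbT.
        by rewrite -cc height_homo.
      have hE : hdiag e c n = hdiag e c i.
        have /subnKC <- : (i <= n)%N by lia.
        have : (i + (n - i) <= n)%N by lia.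
        elim: (n - i)%N => [|d IHd] dn; first by rewrite addn0.
        by rewrite addnS hdiagS !const ?eqxx ?IHd //; lia.
      rewrite hE -(hdiag_comm eP) //.
      pose t := mkseq (fun j => (c j, 0%N)) i.+1.
      have -> := @hdiag_tl_v _ _ _ _ _ eP c i t 0 cP.
      + have [||a [b ab]] := @e_m_part _ _ _ _ _ eP f 0 0 i.+1 => //.
          by lia.
        rewrite -cc cn mulrA ab -mulrA; apply: hspan_ideal; lia.
      + by rewrite size_mkseq.
      + by move=> j ji; rewrite nth_mkseq.
    have [|l [cl il lN cli]] := first_cup cP c2 cc; first by lia.
    have [il1|il1] := eqVneq l i.+1.
      rewrite il1 in cl lN; rewrite (flip_UUD eP cP c1 cl lN) //.
      have fP : height (flip c i.+2) by apply: height_flip => //; lia.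
      apply: hspan_hdiag => //; first by rewrite flipE ifN //; lia.
      split=> [j ji||k ki ck].
      - by rewrite flipE; case: eqP => // ->.
      - by move: cl; rewrite /cup !flipE eqxx !ifN //; lia.
      - by apply: cup_flip => //; lia.
    apply: (far l) => //; try by lia.
    move=> u uP [uc /andP[/eqP u1 _] _]; rewrite u1 c1.
    by apply: leq_trans (uc i _); rewrite ?flipE ?ifN //; lia.
  have ci : cup c i by rewrite /cup c1 eqxx; lia.
  have [|g gE] := @cup_factor _ _ _ _ _ eP c i n cP ci; first by lia.
  have -> : hdiag e c n * e i.+1 = x *: hdiag e c n.
    by rewrite gE -mulrA; have [-> _ _] := eP; rewrite scalerAr.
  by apply: hspanZ; apply: hspan_hdiag.
have [c2|c2] := eqVneq (c i.+2) (c i.+1).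
  have c1' : c i.+1 = (c i).+1 by lia.
  set c' := [eta c with i.+1 |-> c i].
  have c'P : height c' by apply: height_lower.
  have c'E j : c' j = if j == i.+1 then c i else c j by [].
  have c'i : cup c' i by rewrite /cup !c'E !eqxx !ifN //; lia.
  have -> : hdiag e c n = hdiag e (flip c' i.+1) n.
    by apply: hdiag_ext => j _; rewrite flipE !c'E eqxx; case: eqP => // ->.
  rewrite (flip_act eP c'P c'i) //; apply: hspan_hdiag => //.
    by rewrite c'E ifN //; lia.
  split=> [j ji||k ki] //; first by rewrite c'E (negPf ji).
  by rewrite /cup !c'E !ifN //; lia.
have c2' : c i.+2 = (c i.+1).+1 by lia.
have [l [cl li cE]] := last_cup cP c2'.
have [E|li1] := eqVneq l.+1 i.
  subst i; have c3 : c l.+3 = (c l).+2 by lia.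
  rewrite (flip_UDD eP cP cl c3) //.
  have fP : height (flip c l.+1).
    by apply: height_flip => //; have := height_step cP l.+3; lia.
  apply: hspan_hdiag => //; first by rewrite flipE ifN //; lia.
  split=> [j ji||k ki ck].
  - by rewrite flipE; case: eqP => // ->.
  - by move: cl; rewrite /cup !flipE eqxx !ifN //; lia.
  - by apply: cup_flip => //; lia.
have li2 : (l.+1 < i)%N.
  have [E|] := eqVneq l i; last by lia.
  by move: cl; rewrite E /cup; lia.
have := height_step cP i.+2.
move=> s2; apply: (far l) => //; try by lia.
move=> u uP [uc /andP[/eqP u1 /eqP u2] _].
by have := uc i.+2; rewrite flipE ifN; lia.
Qed.


(** * The triangular action of z_k on half-diagrams *)

Local Notation Y := (tl_central x e).
Local Notation p := (tl_p x).

Definition higher k c u : Prop := (forall j, (c j <= u j)%N) /\ (c k < u k)%N.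

Definition tl_weight k i : R := p i * p (k - i).+1.

(** With g and h the eigenvalues expected for [u] and [y] on [a], the defect of the next z is
    expressed through the two previous defects and terms containing [a * b]. *)
Lemma central_recurrence (a y u b : A) (q g h : R) :
  a * (x *: u - y - b * u - u * b + (x *: y + q%:A) * b) - (x * g - h) *: a =
  x *: (a * u - g *: a) - (a * y - h *: a) - a * b * u - (a * u - g *: a) * b
  + x *: ((a * y - h *: a) * b) + (x * h + q - g) *: (a * b).
Proof.
have := @central_step_act A x%:A q%:A b y u (@commr_alg _ _ x) (@commr_alg _ _ q) a g%:A h%:A
  (@commr_alg _ _ g) (@commr_alg _ _ h).
have xgE : x%:A * g%:A - h%:A = (x * g - h)%:A :> A.
  by rewrite mulr_algl scalerA -scalerBl.
have xhE : x%:A * h%:A + q%:A - g%:A = (x * h + q - g)%:A :> A.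
  by rewrite mulr_algl scalerA -scalerDl -scalerBl.
by rewrite xgE xhE !mulr_algl -scalerAl.
Qed.

(** Induction on k, then on the deficit, by the letters k+1 and k+2. A cup reduces to z_k by
    absorption, two opening letters use the recursion, and otherwise a generator commuting with
    z_(k+2) is split off on the right. *)
Lemma hdiag_central k c : (k <= n)%N -> height c -> c n = f ->
  hspan (higher k c) (hdiag e c n * Y k - tl_weight k (c k) *: hdiag e c n).
Proof.
elim/ltn_ind: k c => -[|[|k]] IH c kN cP cn.
- rewrite /tl_weight; have [-> _] := cP.
  by rewrite /= mulr0 mul0r scale0r subr0; apply: hspan0.
- have -> : c 1%N = 0%N by have := height_step cP 1; lia.
  by rewrite /tl_weight /= mulr0 mul0r scale0r subr0; apply: hspan0.
have [cY eY _] := tl_central_spec eP kN.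
have act a P Q i : (i.+1 < n)%N -> hspan P a ->
    (forall u v, height u -> P u -> height v -> reach u i v -> Q v) ->
    hspan Q (a * e i.+1).
  move=> iN Pa PQ; apply: hspan_mulr Pa _ => u uP un Pu.
  by apply: hspan_sub (hdiag_act uP un iN) => v vP _; apply: PQ uP Pu vP.
(* Stated for every [c'], with an extra strict inequality at step k, because the last case applies
   it to another word. *)
have UD c' : height c' -> c' n = f -> cup c' k ->
    hspan (fun u => higher k.+2 c' u /\ (c' k < u k)%N)
      (hdiag e c' n * Y k.+2 - tl_weight k.+2 (c' k.+2) *: hdiag e c' n).
  move=> {}cP {}cn ck; have /andP[/eqP c1 /eqP c2] := ck.
  have [g gE] := @cup_factor _ _ _ _ _ eP c' k n cP ck kN.
  have kc := height_step cP k.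
  have -> : hdiag e c' n * Y k.+2 - tl_weight k.+2 (c' k.+2) *: hdiag e c' n =
      hdiag e c' n * Y k - tl_weight k (c' k) *: hdiag e c' n.
    rewrite gE -mulrA eY // mulrA -gE /tl_weight c2 subSS.
    have -> : (k.+1 - c' k).+1 = (k - c' k).+2 by lia.
    rewrite tl_p_cross mulrDr mulr_algr scalerDl opprD addrACA.
    have -> : (c' k + (k - c' k).+1).+1 = k.+2 by lia.
    by rewrite subrr addr0.
  have [ck1|ck1] := leqP (c' k).+1.*2 k.+1.
    (* e_(k+1) commutes with z_k and acts last, so [v] has a cup at k and v(k+2) = v(k) + 1 exceeds
       c'(k+2). *)
    have fP := height_flip cP ck ck1.
    have fk : flip c' k.+1 k = c' k by rewrite flipE ltn_eqF.
    rewrite -(flip_act eP cP ck kN) -mulrA (tl_central_comm_gt eP) // mulrA.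
    rewrite scalerAl -mulrBl -fk.
    apply: (act _ (higher k (flip c' k.+1))) => //.
      by apply: IH => //; rewrite ?flipE ?ifN //; lia.
    move=> u v uP [cu ku] vP [uv /andP[/eqP v1 /eqP v2] _]; rewrite fk in ku *.
    have vk := uv k; split; last by lia.
    split=> [j|]; last by lia.
    have [->|jk] := eqVneq j k.+1; first by lia.
    by apply: leq_trans (uv _ jk); apply: leq_trans (cu j); rewrite flipE (negPf jk).
  (* Here c'(k) = k/2 is maximal, so no word is higher at step k. *)
  apply: hspan_sub (IH k _ c' _ cP cn) => // [u uP un [cu ku]|]; last by lia.
  by have := height_step uP k; lia.
have [m] := ubnP (deficit n c); elim: m c cP cn => // m IHm c cP cn cm.
have s0 := height_step cP k; have s1 := height_step cP k.+1.
have push l : cup c l -> (l <= k)%N -> ((c l).+1.*2 <= l.+1)%N ->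
    hspan (higher k.+2 c) (hdiag e c n * Y k.+2 - tl_weight k.+2 (c k.+2) *: hdiag e c n).
  move=> cl lk cl2; have fP := height_flip cP cl cl2.
  rewrite -(flip_act eP cP cl); last by lia.
  rewrite -mulrA cY; last by lia.
  rewrite mulrA scalerAl -mulrBl.
  have -> : c k.+2 = flip c l.+1 k.+2 by rewrite flipE ifN //; lia.
  apply: (act _ (higher k.+2 (flip c l.+1))) => //; first by lia.
    apply: IHm => //; first by rewrite flipE ifN //; lia.
    apply: leq_trans (_ : deficit n c <= m)%N; last by lia.
    apply: (@deficit_lt _ _ _ l.+1); last 2 first.
    - by lia.
    - by have := height_step fP l.+1; lia.
    - by move=> j; rewrite flipE; case: eqP => // ->.
    - by rewrite flipE eqxx.
  move=> u v uP [cu ku] vP [uv /andP[/eqP v1 _] _]; split=> [j|].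
    have [->|jl] := eqVneq j l.+1.
      rewrite v1; have /andP[/eqP -> _] := cl.
      apply: leq_trans (uv l _); last by lia.
      by apply: leq_trans (cu l); rewrite flipE ifN //; lia.
    by apply: leq_trans (uv _ jl); apply: leq_trans (cu j); rewrite flipE (negPf jl).
  rewrite flipE ifN in ku; last by lia.
  by apply: leq_trans ku (uv _ _); lia.
have [c1|c1] := eqVneq (c k.+1) (c k).
  have [c2|c2] := eqVneq (c k.+2) (c k); last first.
    by apply: hspan_sub (UD c cP cn _) => [u _ _ []//|]; rewrite /cup c1 eqxx; lia.
  have IH1 := IH k.+1 (leqnn _).
  have IH0 := IH k (ltnW (leqnn _)).
  (* Both letters open, so the weight inherits the recursion of [p]. Acting with e_(k+1) creates a
     cup at k, which makes the result strictly higher at step k+2. *)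
  rewrite tl_centralSS c2.
  have -> : tl_weight k.+2 (c k) = x * tl_weight k.+1 (c k) - tl_weight k (c k).
    rewrite /tl_weight.
    have -> : (k.+2 - c k).+1 = (k - c k).+3 by lia.
    have -> : (k.+1 - c k).+1 = (k - c k).+2 by lia.
    by rewrite tl_pSS; ring.
  rewrite central_recurrence.
  have D1 := IH1 c (ltnW kN) cP cn; rewrite c1 in D1.
  have D0 : hspan (higher k c) (hdiag e c n * Y k - tl_weight k (c k) *: hdiag e c n).
    by apply: IH0 => //; lia.
  have Me := hdiag_act cP cn kN.
  have reach_ge v : reach c k v -> forall j, (c j <= v j)%N.
    move=> [cv /andP[/eqP v1 _] _] j; have [->|] := eqVneq j k.+1; last exact: cv.
    by rewrite v1 c1; apply: cv; lia.
  have reach_gt v : reach c k v -> (c k.+2 < v k.+2)%N.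
    move=> rv; have := reach_ge v rv k; have [_ /andP[_ /eqP -> ] _] := rv; lia.
  apply: hspanD; last first.
    apply: hspanZ.
    by apply: hspan_sub Me => v _ _ rv; split; [apply: reach_ge | apply: reach_gt].
  apply: hspanD; last first.
    apply: hspanZ; apply: (act _ _ _ k kN D0).
    move=> u v uP [cu ku] vP [uv /andP[/eqP v1 /eqP v2] _].
    have vk := uv k; have ck := cu k; split=> [j|]; last by lia.
    have [->|jk] := eqVneq j k.+1; first by lia.
    by apply: leq_trans (uv _ jk).
  apply: hspanB; last first.
    apply: (act _ _ _ k kN D1).
    move=> u v uP [cu ku] vP [uv /andP[/eqP v1 /eqP v2] _].
    have vk := uv k; have ck := cu k; have uk := height_step uP k.
    split=> [j|]; last by lia.
    have [->|jk] := eqVneq j k.+1; first by lia.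
    by apply: leq_trans (uv _ jk).
  apply: hspanB; last first.
    apply: hspan_mulr Me _ => v vP vn rv.
    have vc := reach_ge v rv; have vk := reach_gt v rv.
    rewrite -[_ * _](subrK (tl_weight k.+1 (v k.+1) *: hdiag e v n)).
    apply: hspanD; last by apply: hspanZ; apply: hspan_hdiag.
    apply: hspan_sub (IH1 v (ltnW kN) vP vn) => u uP _ [vu ku]; split.
      by move=> j; apply: leq_trans (vu j).
    by apply: leq_trans vk (vu _).
  apply: hspanB.
    apply: hspanZ; apply: hspan_sub D1 => u uP _ [cu ku]; split=> //.
    by have := height_step uP k.+1; lia.
  apply: hspan_sub D0 => u uP _ [cu ku]; split=> //.
  by have := height_step uP k.+1; have := height_step uP k; lia.
have c1' : c k.+1 = (c k).+1 by lia.
have [c2|c2] := eqVneq (c k.+2) (c k.+1); last first.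
  have c2' : c k.+2 = (c k.+1).+1 by lia.
  have [l [cl lk cE]] := last_cup cP c2'.
  have lk1 : l != k by apply: contraTneq cl => ->; rewrite /cup c1' gtn_eqF.
  by apply: (push l) => //; have := height_step cP k.+2; lia.
have [l [cl lk cE]] := last_cup cP c1'.
have [lk1|lk1] := eqVneq l.+1 k; last by apply: (push l) => //; lia.
(* Letters l+1 to l+3 read open, close, open: [c] is the zigzag image under e_(l+1) of the
   open-open-close word [c']. The extra inequality of [UD] makes up for c'(l+2) < c(l+2). *)
subst k; have /andP[/eqP l1 /eqP l2] := cl.
set c' := [eta c with l.+2 |-> c l.+1].
have c'P : height c' by apply: height_lower.
have c'E j : c' j = if j == l.+2 then c l.+1 else c j by [].
have c'l : cup c' l.+1 by rewrite /cup !c'E eqxx !ifN //; lia.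
have fE : hdiag e (flip c' l.+2) n = hdiag e c n.
  by apply: hdiag_ext => j _; rewrite flipE !c'E eqxx; case: eqP => // ->.
rewrite -fE -(flip_UUD eP c'P _ c'l) //; last by rewrite !c'E !ifN //; lia.
rewrite -mulrA cY; last by lia.
rewrite mulrA scalerAl -mulrBl.
have c3E : c l.+3 = c' l.+3 by rewrite c'E ifN //; lia.
have c'n : c' n = f by rewrite c'E ifN //; lia.
rewrite c3E; apply: (act _ _ _ l _ (UD c' c'P c'n c'l)); first by lia.
move=> u v uP [[cu ku] lu] vP [uv /andP[/eqP v1 /eqP v2] _].
have u1 := height_step uP l.+1.
have cu0 : (c l <= u l)%N by apply: leq_trans (cu l); rewrite c'E ifN //; lia.
have uv0 : (u l <= v l)%N by apply: uv; lia.
rewrite c'E ifN in lu; last by lia.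
split=> [j|]; last first.
  by rewrite c3E; apply: leq_trans ku (uv _ _); lia.
have [->|jl1] := eqVneq j l.+1; first by rewrite l1 v1; lia.
have [->|jl2] := eqVneq j l.+2.
  by apply: leq_trans (uv l.+2 _); lia.
by apply: leq_trans (uv _ jl1); apply: leq_trans (cu j); rewrite c'E (negPf jl2).
Qed.

End Span.

(** * Tableaux and the cell module *)

Lemma tl_e_relations (R : comNzRingType) (x : R) n : TL_relations x (tl_e x n) n.
Proof. by split; [exact: e_sq | exact: e_braid | exact: e_comm]. Qed.

Section Tableaux.
Variables (n : nat) (la : tl_partn n).
Implicit Types (t : tableau la) (c u : nat -> nat).

(** [height] constrains every step, so the tableau is continued by a constant beyond n. *)
Definition tab_height t (j : nat) : nat := (nth (0, 0)%N t (minn j n)).1.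

Lemma size_tab t : size t = n.+1.
Proof. by have /and5P[/eqP] := valP t. Qed.

Lemma Shape_tab t : Shape t = la.
Proof. by have /and5P[_ _ _ _ /eqP] := valP t. Qed.

Lemma Shape_restr t k : (k <= n)%N -> (Shape (restr k t)).1 = tab_height t k.
Proof.
move=> kn; rewrite /Shape /restr /tab_height (minn_idPl kn) -nth_last.
by rewrite size_takel ?size_tab // nth_take.
Qed.

Lemma tab_height_n t : tab_height t n = (pshape la).1.
Proof.
by rewrite -Shape_restr // /restr take_oversize ?Shape_tab // size_tab.
Qed.

Lemma height_tab t : height (tab_height t).
Proof.
have /and5P[_ /forallP tP /eqP t0 /forallP tA _] := valP t.
have half j : ((tab_height t j).*2 <= minn j n)%N.
  have jn : (minn j n < n.+1)%N by rewrite ltnS geq_minr.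
  by have := tP (Ordinal jn); rewrite /is_part /= /tab_height; lia.
split=> [|j]; first by rewrite /tab_height min0n t0.
have jP := half j.
have [jn|nj] := leqP n j; last first.
  have := tA (Ordinal nj); rewrite /arrow /= -!pair_eqE /= /tab_height.
  by have := half j; rewrite /tab_height !(minn_idPl _) //; lia.
have -> : tab_height t j.+1 = tab_height t j.
  by rewrite /tab_height !(minn_idPr _) //; lia.
by rewrite leqnn leqnSn; lia.
Qed.

Lemma tab_of_height c : height c -> c n = (pshape la).1 ->
  exists t, forall j, (j <= n)%N -> tab_height t j = c j.
Proof.
move=> cP cn.
have [s sz sE] : exists2 s : seq tl_shape, size s = n.+1 &
    forall j, (j <= n)%N -> nth (0, 0)%N s j = (c j, j - (c j).*2)%N.
  exists (mkseq (fun j => (c j, j - (c j).*2)%N) n.+1); first exact: size_mkseq.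
  by move=> j jn; rewrite nth_mkseq.
have sP : is_tableau n la s.
  apply/and5P; split.
  - by rewrite sz.
  - apply/forallP => -[k kn]; rewrite /= sE // /is_part /=.
    by have := height_step cP k; lia.
  - by rewrite sE //; have [-> _] := cP.
  - apply/forallP => -[k kn]; rewrite /= !sE ?(ltnW kn) // /arrow /= !xpair_eqE.
    by have := height_step cP k; have := height_step cP k.+1; lia.
  rewrite /Shape -nth_last sz sE // cn.
  have : is_part n (pshape la) := valP la.
  rewrite /is_part; case: (pshape la) => a b /= ab.
  by apply/eqP; congr (_, _); lia.
exists (Tableau sP) => j jn; rewrite /tab_height (minn_idPl jn) /=.
by rewrite sE.
Qed.

Section CellSpan.
Variables (R : comNzRingType) (x : R) (A : algType R) (e : nat -> A).
Hypothesis eP : TL_relations x e n.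

Lemma hdiag_tab t c : height c -> (forall j, (j <= n)%N -> tab_height t j = c j) ->
  hdiag e c n = m_part e la * tl_v e n t.
Proof.
move=> cP tc; have -> : m_part e la = m_part e (c n, (pshape la).2).
  by rewrite /m_part -tc // tab_height_n.
apply: (hdiag_tl_v eP) => //; first exact: size_tab.
by move=> j jn; rewrite -tc // /tab_height (minn_idPl jn).
Qed.

(** The shape (f+1, n-2f-2) strictly dominates [la], and its ideal alone accounts for the
    element. *)
Lemma hspan_ideal_above a b : ((pshape la).1.+1.*2 <= n)%N ->
  a * m_part e ((pshape la).1.+1, 0%N) * b \in ideal_above e la.
Proof.
move=> fn; set m := _ * _ * _.
have muP : is_part n ((pshape la).1.+1, n - (pshape la).1.+1.*2)%N.
  by rewrite /is_part /=; lia.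
pose mu := Partn muP.
apply/asboolP; exists (fun nu => if nu == mu then m else 0).
  move=> nu _; case: eqP => [->|_]; last exact: ideal2_0.
  apply: ideal2_mulr; apply: ideal2_mull; exact: ideal2_gen.
rewrite -big_mkcondr /= (big_pred1 mu) // => nu /=.
case: eqP => [->|_]; last by rewrite andbF.
rewrite andbT; apply/andP; split; first exact: leqnSn.
by apply/eqP => /(congr1 fst) /=; lia.
Qed.

Lemma hspan_tab (P : (nat -> nat) -> Prop) (Q : pred (tableau la)) a :
  (forall c v, height c -> P c ->
    (forall j, (j <= n)%N -> tab_height v j = c j) -> Q v) ->
  hspan e n (pshape la).1 P a ->
  exists r : tableau la -> R, qpi (ideal_above e la) a =
    \sum_(v | Q v) r v *: qpi (ideal_above e la) (m_part e la * tl_v e n v).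
Proof.
move=> PQ; elim=> [|a1 a2 fn|c cP cn Pc|a1 a2 _ [r1 E1] _ [r2 E2]|k a1 _ [r E]].
- exists (fun=> 0); rewrite qpi0 big1 // => v _; exact: scale0r.
- exists (fun=> 0); rewrite [RHS]big1 => [|v _]; last exact: scale0r.
  by rewrite -(qpi0 (ideal_above e la)); apply/qpiP; rewrite subr0 hspan_ideal_above.
- have [v vc] := tab_of_height cP cn.
  exists (fun w => (w == v)%:R); rewrite (bigD1 v) /=; last exact: PQ vc.
  rewrite eqxx scale1r big1 ?addr0 ?(hdiag_tab cP vc) // => w /andP[_ /negPf->].
  exact: scale0r.
- exists (fun v => r1 v + r2 v); rewrite qpiD E1 E2 -big_split.
  by apply: eq_bigr => v _; rewrite scalerDl.
- exists (fun v => k * r v); rewrite qpiZ E scaler_sumr.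
  by apply: eq_bigr => v _; rewrite scalerA.
Qed.

(** A closing letter leaves k - i unchanged and an opening letter leaves i unchanged, so the two
    weights share a factor. *)
Lemma tl_r_weight t k : (k < n)%N ->
  tl_r x t k.+1 = tl_weight x k.+1 (tab_height t k.+1)
                  - x * tl_weight x k (tab_height t k).
Proof.
move=> kn; have cP := height_tab t; have ck := height_step cP k.
rewrite /tl_r !Shape_restr //=; last exact: ltnW.
case: k kn ck => [|k] kn ck.
  have [-> _] := cP; have -> : tab_height t 1%N = 0%N.
    by have := height_step cP 1; lia.
  by rewrite /tl_weight /= !mul0r mulr0 subr0.
rewrite /= /tl_weight; case: eqP => [<-|cne].
  by rewrite subSS /=; ring.
have -> : tab_height t k.+2 = tab_height t k.+1 by lia.
have -> : (k.+2 - tab_height t k.+1)%N = (k.+1 - tab_height t k.+1).+1 by lia.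
by rewrite tl_pSS; ring.
Qed.

(** The error terms of z_(k+1) are strict at step k+1 and those of z_k at step k; [l] stands for
    either. *)
Lemma hspan_tl_T t k : (k < n)%N ->
  hspan e n (pshape la).1
    (fun u => (forall j, (tab_height t j <= u j)%N) /\
              exists2 l, (l <= n)%N & (tab_height t l < u l)%N)
    (hdiag e (tab_height t) n * tl_T x e k.+1
     - tl_r x t k.+1 *: hdiag e (tab_height t) n).
Proof.
move=> kn; have cP := height_tab t; have cn := tab_height_n t.
rewrite tl_r_weight // (tl_TE eP kn).1 mulrBr -scalerAr.
set M := hdiag _ _ _; set a := M * _; set b := M * _.
set g := tl_weight _ _ _; set h := tl_weight _ _ _.
have -> : a - x *: b - (g - x * h) *: M = (a - g *: M) - x *: (b - h *: M).
  by rewrite scalerBl scalerBr scalerA !opprB addrACA [RHS]addrACA;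
    congr (_ + _); rewrite addrC.
apply: hspanB; last apply: hspanZ.
  apply: hspan_sub (hdiag_central eP kn cP cn) => u _ _ [cu ku].
  by split=> //; exists k.+1.
apply: hspan_sub (hdiag_central eP (ltnW kn) cP cn) => u _ _ [cu ku].
by split=> //; exists k; rewrite // ltnW.
Qed.

End CellSpan.
End Tableaux.

Theorem corollary3p6 (n : nat) (la : tl_partn n) (t : tableau la) (k : nat)
    (k_le_n : (k <= n)%N) :
  exists a : tableau la -> {poly int},
    cell_act (m_tab (tl_e tl_x n) t) (tl_T tl_x (tl_e tl_x n) k) =
      tl_r tl_x t k *: m_tab (tl_e tl_x n) t
      + \sum_(v : tableau la | tab_sdominates v t) a v *: m_tab (tl_e tl_x n) v.
Proof.
have eP := tl_e_relations tl_x n.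
have hE := hdiag_tab eP (height_tab t) (fun j _ => erefl (tab_height t j)).
have [a aE] : exists a : tableau la -> {poly int},
    qpi (ideal_above (tl_e tl_x n) la)
      (m_part (tl_e tl_x n) la * tl_v (tl_e tl_x n) n t * tl_T tl_x (tl_e tl_x n) k
       - tl_r tl_x t k *: (m_part (tl_e tl_x n) la * tl_v (tl_e tl_x n) n t)) =
    \sum_(v | tab_sdominates v t) a v *:
      qpi (ideal_above (tl_e tl_x n) la)
        (m_part (tl_e tl_x n) la * tl_v (tl_e tl_x n) n v).
  case: k k_le_n => [|k] kn.
    exists (fun=> 0); rewrite tl_T0 mulr0 /tl_r /= scale0r subr0 qpi0 big1 // => v _.
    exact: scale0r.
  have := hspan_tl_T eP t kn; rewrite hE.
  apply: (hspan_tab eP) => u v uP [cu [l ln lu]] vu.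
  have vt j : (j <= n)%N -> (tab_height t j <= tab_height v j)%N.
    by move=> jn; rewrite vu.
  rewrite /tab_sdominates; apply/andP; split.
    apply/forallP => -[j jn]; apply/implyP => _.
    by rewrite /dominates /= !Shape_restr // vt.
  (* Strictness at step l rules out [v = t]. *)
  by apply: contraTneq lu => vt'; rewrite -vu // vt' ltnn.
exists a; apply: val_inj => /=.
rewrite (big_morph _ (@cell_valD _ _ _ _ _) (@cell_val0 _ _ _ _ _)).
under eq_bigr do rewrite cell_valZ.
by rewrite qactE /= -aE -qpiZ -qpiD addrC subrK.
Qed.
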